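(* Let $\omega^2>0$ be fixed. Let $\mathbf q=(\mathbf q_{ij})_{1\le i<j\le N}$ be a family of nonzero vectors of $\mathbb R^2$ satisfying the triangle relations $\mathbf q_{1i}+\mathbf q_{ij}-\mathbf q_{1j}=0$ for all $2\le i<j\le N$, and let $\mathbf r=(\mathbf r_1,\dots,\mathbf r_N)$ be the underlying position vector, i.e. the unique $\mathbf r\in(\mathbb R^2)^N$ with $\mathbf r_i-\mathbf r_j=\mathbf q_{ij}$ for $i<j$ and $\sum_i m_i\mathbf r_i=0$. Then there exist multipliers $\boldsymbol\phi=(\boldsymbol\phi_{ij})_{2\le i<j\le N}$, $\boldsymbol\phi_{ij}\in\mathbb R^2$, such that $\mathbf q$ is a critical point of the augmented functional $\mathcal F(\cdot,\boldsymbol\phi)$ (that is, $\nabla_{\mathbf q_{ij}}\mathcal F(\mathbf q,\boldsymbol\phi)=0$ for all $1\le i<j\le N$, the vectors $\mathbf q_{ij}$ being treated as independent variables) if and only if $\mathbf r$ satisfies the classical central configuration equations $$\omega^2 m_i\mathbf r_i=\sum_{j\ne i}\frac{m_im_j}{|\mathbf r_i-\mathbf r_j|^3}(\mathbf r_i-\mathbf r_j),\qquad i=1,\dots,N.$$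
   Context: $m_1,\dots,m_N>0$ are masses, $M=\sum_i m_i$, $\mu_{ij}=m_im_j/M$, and $q_{ij}=|\mathbf q_{ij}|$. The ambient pair space is $\mathcal P=\prod_{1\le i<j\le N}\mathbb R^2$ (all pair vectors vary independently). On the set of $\mathbf q\in\mathcal P$ with all $\mathbf q_{ij}\neq0$ define $$U_\pi(\mathbf q)=\sum_{i<j}\frac{M\mu_{ij}}{q_{ij}},\qquad I_\pi(\mathbf q)=\sum_{i<j}\mu_{ij}q_{ij}^2,$$ $$\mathcal F(\mathbf q,\boldsymbol\phi)=U_\pi(\mathbf q)+\frac{\omega^2}{2}I_\pi(\mathbf q)+\sum_{2\le k<l\le N}\boldsymbol\phi_{kl}\cdot(\mathbf q_{1k}+\mathbf q_{kl}-\mathbf q_{1l}).$$ *)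

(* Defs.v *)
From HB Require Import structures.
From mathcomp Require Import all_boot all_order all_algebra.
From mathcomp Require Import all_classical all_reals all_analysis.
Set Implicit Arguments.
Unset Strict Implicit.
Unset Printing Implicit Defensive.
Import Order.TTheory GRing.Theory Num.Theory.
Import numFieldNormedType.Exports.
Local Open Scope ring_scope.

(* There are N = n.+1 bodies, indexed from 0: body 1 of the mathematical text
   is ord0 : 'I_n.+1, and bodies 2..N are the lift ord0 k for k : 'I_n. *)

Definition ipair (n : nat) := {p : 'I_n * 'I_n | (p.1 < p.2)%N}.

Definition fst_idx n (p : ipair n) : 'I_n := (val p).1.
Definition snd_idx n (p : ipair n) : 'I_n := (val p).2.

Definition root_pair n (k : 'I_n) : ipair n.+1 :=
  exist _ (ord0, lift ord0 k) (isT : (ord0 < lift ord0 k)%N).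

(* A pair of indices among the bodies 2..N is an ipair n; [tail_pair] is the
   inclusion of those pairs into the pairs of all bodies. *)
Definition tail_pair n (p : ipair n) : ipair n.+1 :=
  exist _ (lift ord0 (fst_idx p), lift ord0 (snd_idx p))
    (valP p : (lift ord0 (fst_idx p) < lift ord0 (snd_idx p))%N).

Section Plane.
Variable R : realType.
Implicit Types u v : 'rV[R]_2.

Definition dotp u v : R := \sum_k u 0 k * v 0 k.

(* The library norm `|v| of a row vector is the sup norm. *)
Definition enorm v : R := Num.sqrt (dotp v v).

Definition has_gradient (f : 'rV[R]_2 -> R) v (g : 'rV[R]_2) : Prop :=
  is_diff v (f : 'rV[R]_2 -> R^o) (fun h => dotp g h : R^o).

End Plane.

Section PairSpace.
Variables (R : realType) (n : nat) (m : 'I_n.+1 -> R).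

Definition pair_space := ipair n.+1 -> 'rV[R]_2.

Definition multipliers := ipair n -> 'rV[R]_2.

Definition total_mass : R := \sum_i m i.

Definition mu (p : ipair n.+1) : R :=
  m (fst_idx p) * m (snd_idx p) / total_mass.

Definition U_pi (q : pair_space) : R :=
  \sum_p total_mass * mu p / enorm (q p).

Definition I_pi (q : pair_space) : R := \sum_p mu p * enorm (q p) ^+ 2.

Definition triangle_defect (q : pair_space) (p : ipair n) : 'rV[R]_2 :=
  q (root_pair (fst_idx p)) + q (tail_pair p) - q (root_pair (snd_idx p)).

Definition augmented (omega : R) (q : pair_space) (phi : multipliers) : R :=
  U_pi q + omega ^+ 2 / 2 * I_pi q + \sum_p dotp (phi p) (triangle_defect q p).

(* For every pair, the gradient in the corresponding vector alone, all other
   pair vectors being kept fixed, exists and vanishes. *)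
Definition critical_point (F : pair_space -> R) (q : pair_space) : Prop :=
  forall p, has_gradient (fun v => F [eta q with p |-> v]) (q p) 0.

Definition underlying_position (q : pair_space) (r : 'I_n.+1 -> 'rV[R]_2)
    : Prop :=
  (forall p, r (fst_idx p) - r (snd_idx p) = q p) /\ \sum_i m i *: r i = 0.

Definition central_configuration (omega : R) (r : 'I_n.+1 -> 'rV[R]_2)
    : Prop :=
  forall i, (omega ^+ 2 * m i) *: r i =
    \sum_(j | j != i) (m i * m j / enorm (r i - r j) ^+ 3) *: (r i - r j).

Lemma underlying_position_exists_unique (q : pair_space) :
  (forall i, 0 < m i) -> (forall p, triangle_defect q p = 0) ->
  exists! r, underlying_position q r.
Proof.
move=> m_gt0 tri.
have M0 : total_mass != 0.
  rewrite gt_eqF// /total_mass big_ord_recl ltr_pwDl//.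
  by apply: sumr_ge0 => i _; exact: ltW.
pose s (i : 'I_n.+1) : 'rV[R]_2 :=
  if unlift ord0 i is Some k then q (root_pair k) else 0.
pose a := total_mass^-1 *: \sum_i m i *: s i.
have s0 : s ord0 = 0 by rewrite /s unlift_none.
have sl k : s (lift ord0 k) = q (root_pair k) by rewrite /s liftK.
have sP p : s (snd_idx p) - s (fst_idx p) = q p.
  case: p => -[i j] /= ltij; rewrite /fst_idx /snd_idx /=.
  case: (unliftP ord0 j) ltij => [l ->|->] //.
  case: (unliftP ord0 i) => [k ->|->] ltij; last first.
    by rewrite s0 subr0 sl; congr q; exact: val_inj.
  rewrite !sl.
  have ltkl : (k < l)%N by [].
  move: (tri (exist _ (k, l) ltkl)); rewrite /triangle_defect /fst_idx /snd_idx.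
  move=> /= /subr0_eq <-; rewrite addrC addKr; congr q; exact: val_inj.
exists (fun i => a - s i); split; first split.
- by move=> p; rewrite opprB addrC addrA subrK sP.
- under eq_bigr do rewrite scalerBr.
  rewrite sumrB -scaler_suml -/total_mass /a scalerA divff// scale1r.
  by rewrite subrr.
move=> r [rq rm]; apply/funext => i.
have rs j : r j = r ord0 - s j.
  case: (unliftP ord0 j) => [k ->|->]; last by rewrite s0 subr0.
  by rewrite sl -(rq (root_pair k)) subKr.
rewrite [RHS]rs; congr (_ - _).
move: rm; under eq_bigr do rewrite rs scalerBr.
rewrite sumrB -scaler_suml -/total_mass => /subr0_eq.
by rewrite /a => <-; rewrite scalerA mulVf// scale1r.
Qed.

End PairSpace.

(* Main.v *)
From HB Require Import structures.
Require Import Defs.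
From mathcomp Require Import all_boot all_order all_algebra.
From mathcomp Require Import all_classical all_reals all_analysis.
From mathcomp Require Import ring.
Set Implicit Arguments.
Unset Strict Implicit.
Unset Printing Implicit Defensive.
Import Order.TTheory GRing.Theory Num.Theory.
Import numFieldNormedType.Exports.
Local Open Scope ring_scope.

(* Extend the gradients W_ij = mu_ij (omega^2 - M / q_ij^3) q_ij of the
   unconstrained functional antisymmetrically in (i, j).  The equation of a pair
   k < l of bodies 2..N forces phi_kl = - W_kl, and with this choice the
   equation of the pair (1, k) says that the row sum of W at k vanishes.  By
   antisymmetry the row sums add up to 0, so the one at body 1 then vanishes as
   well.  Since the center of mass is at 0, the row sum at i is the difference
   of the two sides of the i-th central configuration equation. *)

(** * Gradients of functions on the plane *)

Section Gradient.
Variable R : realType.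
Implicit Types (u v g : 'rV[R]_2) (f : 'rV[R]_2 -> R).

Lemma dotpE u v : dotp u v = u 0 0 * v 0 0 + u 0 1 * v 0 1.
Proof.
rewrite /dotp !big_ord_recl big_ord0 addr0.
by rewrite (_ : lift _ _ = 1) //; exact: val_inj.
Qed.

Lemma dotpC u v : dotp u v = dotp v u.
Proof. by apply: eq_bigr => k _; rewrite mulrC. Qed.

Lemma dotpDl u u' v : dotp (u + u') v = dotp u v + dotp u' v.
Proof. by rewrite -big_split; apply: eq_bigr => k _; rewrite mxE mulrDl. Qed.

Lemma dotpZl a u v : dotp (a *: u) v = a * dotp u v.
Proof. by rewrite mulr_sumr; apply: eq_bigr => k _; rewrite mxE mulrA. Qed.

Lemma dotp0l v : dotp 0 v = 0.
Proof. by rewrite -(scale0r 0) dotpZl mul0r. Qed.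

Lemma dotpDr u v v' : dotp u (v + v') = dotp u v + dotp u v'.
Proof. by rewrite dotpC dotpDl !(dotpC u). Qed.

Lemma dotpZr a u v : dotp u (a *: v) = a * dotp u v.
Proof. by rewrite dotpC dotpZl dotpC. Qed.

Lemma dotp_suml (I : finType) (F : I -> 'rV[R]_2) v :
  dotp (\sum_i F i) v = \sum_i dotp (F i) v.
Proof.
by elim/big_rec2: _ => [|i x y _ <-]; [exact: dotp0l | exact: dotpDl].
Qed.

Lemma dotpvv_gt0 v : v != 0 -> 0 < dotp v v.
Proof.
move=> v0; rewrite lt_neqAle sumr_ge0 => [|k _]; last by rewrite -expr2 sqr_ge0.
rewrite andbT eq_sym; apply: contra v0 => /eqP vv0.
apply/eqP/rowP => k; rewrite mxE; apply/eqP; rewrite -sqrf_eq0 expr2.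
by apply/eqP; move: k isT; apply: psumr_eq0P vv0 => k _; rewrite -expr2 sqr_ge0.
Qed.

Lemma enorm_neq0 v : v != 0 -> enorm v != 0.
Proof. by move=> v0; rewrite gt_eqF// sqrtr_gt0 dotpvv_gt0. Qed.

Lemma enormN v : enorm (- v) = enorm v.
Proof. by rewrite /enorm -scaleN1r dotpZl dotpZr mulrA mulrNN !mul1r. Qed.

Lemma dotp_delta k v : dotp (delta_mx 0 k) v = v 0 k.
Proof.
rewrite /dotp (bigD1 k)//= big1 ?addr0 => [|j jk].
  by rewrite mxE !eqxx mul1r.
by rewrite mxE (negbTE jk) andbF mul0r.
Qed.

(** The differential at a point is unique, and its values on the basis vectors are the coordinates
    of the gradient. *)
Lemma has_gradient_unique f v g g' :
  has_gradient f v g -> has_gradient f v g' -> g = g'.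
Proof.
move=> [_ dg] [_ dg']; apply/rowP => k.
rewrite -!(dotp_delta k) !(dotpC (delta_mx _ _)).
by move/(congr1 (@^~ (delta_mx 0 k))): dg; rewrite dg'.
Qed.

Lemma has_gradient_cst a v : has_gradient (fun=> a) v 0.
Proof.
apply: (is_diff_eq (is_diff_cst (a : R^o) v)).
by apply/funext => h; rewrite dotp0l.
Qed.

Lemma has_gradientD f f' v g g' : has_gradient f v g -> has_gradient f' v g' ->
  has_gradient (fun u => f u + f' u) v (g + g').
Proof.
move=> fg fg'; apply: (is_diff_eq (is_diffD fg fg')).
by apply/funext => h; rewrite dotpDl.
Qed.

Lemma has_gradientZ a f v g : has_gradient f v g ->
  has_gradient (fun u => a * f u) v (a *: g).
Proof.
move=> fg; apply: (is_diff_eq (is_diffZ a fg)).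
by apply/funext => h; rewrite dotpZl.
Qed.

Lemma has_gradient_dotp g v : has_gradient (dotp g) v g.
Proof.
have dotp_lin : linear (dotp g : _ -> R^o).
  by move=> a u w; rewrite dotpDr dotpZr.
have dotp_cont : continuous (dotp g : _ -> R^o).
  have coord_cont k : continuous (fun u : 'rV[R]_2 => g 0 k * u 0 k).
    by move=> u; apply: (@cvgMl_tmp R _ (nbhs u)); exact: coord_continuous.
  rewrite (_ : dotp g = fun u => g 0 0 * u 0 0 + g 0 1 * u 0 1).
    by move=> u; apply: (@cvgD R R^o _ (nbhs u)); exact: coord_cont.
  by apply/funext => w; exact: dotpE.
pose dotpL : {linear 'rV[R]_2 -> R^o} :=
  HB.pack (dotp g : _ -> R^o) (GRing.isLinear.Build _ _ _ _ _ dotp_lin).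
have dotpL_cont : continuous dotpL by [].
split; first exact: linear_differentiable dotpL_cont.
exact: diff_lin dotpL_cont.
Qed.

Lemma has_gradientM f f' v g g' : has_gradient f v g -> has_gradient f' v g' ->
  has_gradient (fun u => f u * f' u) v (f v *: g' + f' v *: g).
Proof.
move=> fg fg'; apply: (is_diff_eq (is_diffM fg fg')).
by apply/funext => h; rewrite dotpDl !dotpZl.
Qed.

Lemma has_gradient_comp (h : R -> R) f v g d : has_gradient f v g ->
  is_derive (f v) 1 (h : R -> R^o) d ->
  has_gradient (h \o f) v (d *: g).
Proof.
move=> fg [dh hd].
have diffh : differentiable (h : R^o -> R^o) (f v) by exact/derivable1_diffP.
apply: (is_diff_eq (is_diff_comp fg (differentiableP diffh))).
by apply/funext => u /=; rewrite diff1E// derive1E hd dotpZl mulrC.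
Qed.

(** Each coordinate is the linear form [dotp] of a basis vector, so the product rule handles its
    square; the two squares are then added. *)
Lemma has_gradient_sqr v : has_gradient (fun u => dotp u u) v (2 *: v).
Proof.
pose e k : 'rV[R]_2 := delta_mx 0 k.
have sqr_coord k : has_gradient (fun u => u 0 k * u 0 k) v ((2 * v 0 k) *: e k).
  have := has_gradientM (has_gradient_dotp (e k) v) (has_gradient_dotp (e k) v).
  under [X in has_gradient X]eq_fun do rewrite dotp_delta.
  by rewrite dotp_delta -scalerDl mulr_natl.
have := has_gradientD (sqr_coord 0) (sqr_coord 1).
under [X in has_gradient X]eq_fun do rewrite -dotpE.
rewrite -!scalerA -scalerDr; congr (has_gradient _ _ (2 *: _)).
rewrite [RHS]row_sum_delta !big_ord_recl big_ord0 addr0.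
by rewrite (_ : lift _ _ = 1) //; exact: val_inj.
Qed.

Lemma has_gradient_inv_enorm v : v != 0 ->
  has_gradient (fun u => (enorm u)^-1) v (- (enorm v ^+ 3)^-1 *: v).
Proof.
move=> v0; have vv0 := dotpvv_gt0 v0.
have n0 := enorm_neq0 v0.
have dsqrt := is_derive1_sqrt vv0.
have := has_gradient_comp (has_gradient_sqr v) (is_deriveV n0 dsqrt).
congr has_gradient; rewrite scalerA; congr (_ *: _).
(* The inverse, the square root and the square contribute the factors $-|v|^{-2}$, $(2|v|)^{-1}$ and
   $2$. *)
by rewrite -/(enorm v) /GRing.scale /=; field.
Qed.

End Gradient.

(** * Sums over pairs of indices *)

Section PairCombinatorics.

Lemma sum_ipair (V : nmodType) n (F : 'I_n -> 'I_n -> V) :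
  \sum_(p : ipair n) F (fst_idx p) (snd_idx p) =
  \sum_(i < n) \sum_(j < n | (i < j)%N) F i j.
Proof.
rewrite pair_big_dep /=.
rewrite [RHS](reindex_omap (val : ipair n -> _) insub) /=; last first.
  by move=> x lt_x; rewrite insubT.
by apply: eq_bigl => p; rewrite valK eqxx andbT (valP p).
Qed.

Lemma root_pair_eq n (k k' : 'I_n) : (root_pair k == root_pair k') = (k == k').
Proof.
by rewrite -val_eqE /= xpair_eqE eqxx /= (inj_eq lift_inj).
Qed.

Lemma tail_pair_eq n (p p' : ipair n) :
  (tail_pair p == tail_pair p') = (p == p').
Proof. by rewrite -val_eqE /= xpair_eqE !(inj_eq lift_inj). Qed.

Lemma root_tail_neq n (k : 'I_n) p : (root_pair k == tail_pair p) = false.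
Proof. by rewrite -val_eqE. Qed.

(** The larger index is never [ord0], so the case depends only on whether the smaller one is. *)
Lemma ipair_split n (p : ipair n.+1) :
  (exists k, p = root_pair k) \/ (exists p', p = tail_pair p').
Proof.
case: p => -[i j] /=; case: (unliftP ord0 j) => [l ->|->] ltij //.
case: (unliftP ord0 i) ltij => [k ->|->] ltij.
  right; have ltkl : (k < l)%N by [].
  by exists (exist _ (k, l) ltkl); exact: val_inj.
by left; exists l; exact: val_inj.
Qed.

(** The scalar is the signed incidence of [k] with the pair. Pairs starting at [k] give the terms of
    the row with $j > k$; pairs ending at [k] give $-W_{jk} = W_{kj}$ with $j < k$; the diagonal
    term is zero. *)
Lemma sum_incidence (R : pzRingType) (V : lmodType R) n
    (W : 'I_n -> 'I_n -> V) k :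
  (forall i j, W j i = - W i j) -> W k k = 0 ->
  \sum_(p : ipair n) ((fst_idx p == k)%:R - (snd_idx p == k)%:R : R) *:
    W (fst_idx p) (snd_idx p) = \sum_j W k j.
Proof.
move=> anti Wkk.
rewrite (sum_ipair (fun i j => ((i == k)%:R - (j == k)%:R : R) *: W i j)).
under eq_bigr => i _ do
  under eq_bigr => j _ do rewrite scalerBl.
under eq_bigr => i _ do rewrite sumrB.
rewrite sumrB.
have -> : \sum_(i < n) \sum_(j < n | (i < j)%N) ((i == k)%:R : R) *: W i j =
    \sum_(j < n | (k < j)%N) W k j.
  rewrite (bigD1 k)//= [X in _ + X]big1 ?addr0 => [|i /negbTE ik].
    by apply: eq_bigr => j _; rewrite eqxx scale1r.
  by rewrite big1// => j _; rewrite ik scale0r.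
have -> : \sum_(i < n) \sum_(j < n | (i < j)%N) ((j == k)%:R : R) *: W i j =
    - \sum_(j < n | (j < k)%N) W k j.
  rewrite (exchange_big_dep predT)//= (bigD1 k)//= [X in _ + X]big1 ?addr0.
    by rewrite -sumrN; apply: eq_bigr => j _; rewrite eqxx scale1r anti.
  by move=> i /negbTE ik; rewrite big1// => j _; rewrite ik scale0r.
rewrite opprK [RHS](bigID (fun j : 'I_n => (k < j)%N)) /=; congr (_ + _).
rewrite [RHS](bigD1 k) ?ltnn//= Wkk add0r; apply: eq_bigl => j.
by rewrite -leqNgt ltn_neqAle andbC -val_eqE.
Qed.

End PairCombinatorics.

(** * Critical point equations and row sums *)

Section CriticalPoints.
Variables (R : realType) (n : nat) (m : 'I_n.+1 -> R) (omega : R).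
Implicit Types (q : pair_space R n) (phi : multipliers R n).

(** For [q p] nonzero, this is the gradient of $U_\pi + \frac{\omega^2}{2} I_\pi$ in the vector of
    the pair [p] alone. *)
Definition pair_gradient q (p : ipair n.+1) : 'rV[R]_2 :=
  (mu m p * (omega ^+ 2 - total_mass m / enorm (q p) ^+ 3)) *: q p.

(** This is the coefficient (1, -1 or 0) with which [q p] enters [triangle_defect q p']. *)
Definition triangle_coef (p : ipair n.+1) (p' : ipair n) : R :=
  (root_pair (fst_idx p') == p)%:R + (tail_pair p' == p)%:R
  - (root_pair (snd_idx p') == p)%:R.

Lemma triangle_defect_update q p v p' :
  triangle_defect [eta q with p |-> v] p' =
  triangle_defect q p' + triangle_coef p p' *: (v - q p).
Proof.
(* In this form the update is a translation of [q], which the linear triangle relations carry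
   through. *)
have updE x : [eta q with p |-> v] x = q x + (x == p)%:R *: (v - q p).
  rewrite /=; case: eqP => [->|_]; first by rewrite scale1r addrC subrK.
  by rewrite scale0r addr0.
rewrite /triangle_defect !updE /triangle_coef scalerBl scalerDl opprD.
by rewrite (addrACA (q _)) [LHS]addrACA.
Qed.

(** With all other pair vectors fixed, the functional has the form $A/|v| + B|v|^2 + c\cdot v + K$,
    and its terms are differentiated one by one. *)
Lemma augmented_gradient q phi p : q p != 0 ->
  has_gradient (fun v => augmented m omega [eta q with p |-> v] phi) (q p)
    (pair_gradient q p + \sum_p' triangle_coef p p' *: phi p').
Proof.
move=> q0.
pose A := total_mass m * mu m p; pose B := omega ^+ 2 / 2 * mu m p.
pose c := \sum_p' triangle_coef p p' *: phi p'.
(* [K] gathers what is independent of [v]: the other pairs in both sums, and the triangle defects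
   with the contribution of [q p] removed. *)
pose K := \sum_(p' | p' != p) total_mass m * mu m p' / enorm (q p') +
  omega ^+ 2 / 2 * \sum_(p' | p' != p) mu m p' * enorm (q p') ^+ 2 +
  \sum_p' dotp (phi p') (triangle_defect q p' - triangle_coef p p' *: q p).
have augE v : augmented m omega [eta q with p |-> v] phi =
    A * (enorm v)^-1 + B * dotp v v + dotp c v + K.
  have dsum : \sum_p' dotp (phi p') (triangle_defect [eta q with p |-> v] p') =
      dotp c v +
      \sum_p' dotp (phi p') (triangle_defect q p' - triangle_coef p p' *: q p).
    rewrite dotp_suml -big_split; apply: eq_bigr => p' _ /=.
    rewrite triangle_defect_update scalerBr addrCA [LHS]dotpDr.
    by rewrite dotpZr dotpZl.
  have vv : dotp v v = enorm v ^+ 2.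
    by rewrite sqr_sqrtr// sumr_ge0 => // k _; rewrite -expr2 sqr_ge0.
  have sum_update (G : ipair n.+1 -> 'rV[R]_2 -> R) :
      \sum_p' G p' ([eta q with p |-> v] p') =
      G p v + \sum_(p' | p' != p) G p' (q p').
    rewrite (bigD1 p)//= eqxx; congr (_ + _).
    by apply: eq_bigr => p' /negbTE ->.
  rewrite /augmented dsum /U_pi /I_pi.
  rewrite (sum_update (fun p' u => total_mass m * mu m p' / enorm u)).
  rewrite (sum_update (fun p' u => mu m p' * enorm u ^+ 2)).
  by rewrite -vv /K /A /B; ring.
rewrite (funext augE).
have := has_gradientD (has_gradientD (has_gradientD
  (has_gradientZ A (has_gradient_inv_enorm q0))
  (has_gradientZ B (has_gradient_sqr (q p)))) (has_gradient_dotp c (q p)))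
  (has_gradient_cst K (q p)).
rewrite addr0 !scalerA -scalerDl; congr (has_gradient _ _ (_ *: _ + _)).
by rewrite /A /B; field; exact: enorm_neq0.
Qed.

Lemma critical_pointP q phi : (forall p, q p != 0) ->
  critical_point (fun q' => augmented m omega q' phi) q <->
  forall p, pair_gradient q p + \sum_p' triangle_coef p p' *: phi p' = 0.
Proof.
move=> q0; split=> [crit p|grad0 p].
  exact: has_gradient_unique (augmented_gradient phi (q0 p)) (crit p).
by rewrite -(grad0 p); exact: augmented_gradient.
Qed.

(** A pair of bodies 2..N occurs in exactly one triangle relation, its own, with coefficient 1. *)
Lemma sum_triangle_coef_tail phi p :
  \sum_p' triangle_coef (tail_pair p) p' *: phi p' = phi p.
Proof.
rewrite (bigD1 p)//= big1 => [|p' p'p]; rewrite /triangle_coef !root_tail_neq.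
  by rewrite tail_pair_eq eqxx add0r subr0 scale1r addr0.
by rewrite tail_pair_eq (negbTE p'p) add0r subr0 scale0r.
Qed.

Lemma triangle_coef_root k p' :
  triangle_coef (root_pair k) p' = (fst_idx p' == k)%:R - (snd_idx p' == k)%:R.
Proof.
rewrite /triangle_coef !root_pair_eq [tail_pair _ == _]eq_sym root_tail_neq.
by rewrite addr0.
Qed.

(** Written with positions, the pair gradient makes sense for all [i] and [j], in either order and
    on the diagonal, so that row sums can be formed. *)
Definition body_gradient (r : 'I_n.+1 -> 'rV[R]_2) i j : 'rV[R]_2 :=
  (m i * m j / total_mass m *
    (omega ^+ 2 - total_mass m / enorm (r i - r j) ^+ 3)) *: (r i - r j).

Lemma body_gradientC r i j : body_gradient r j i = - body_gradient r i j.
Proof.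
by rewrite /body_gradient -(opprB (r i)) enormN scalerN [m j * _]mulrC.
Qed.

Lemma body_gradientii r i : body_gradient r i i = 0.
Proof. by rewrite /body_gradient subrr scaler0. Qed.

(** Since the center of mass is at 0, $\sum_j m_j(\mathbf r_i - \mathbf r_j) = M\mathbf r_i$, which
    turns the $\omega^2$ part of the row sum into the left side of the equation. *)
Lemma central_configurationP r : total_mass m != 0 -> \sum_i m i *: r i = 0 ->
  central_configuration m omega r <-> forall i, \sum_j body_gradient r i j = 0.
Proof.
move=> M0 rm.
have bodyE i : \sum_j body_gradient r i j = (omega ^+ 2 * m i) *: r i -
    \sum_(j | j != i) (m i * m j / enorm (r i - r j) ^+ 3) *: (r i - r j).
  have -> : \sum_(j | j != i)
        (m i * m j / enorm (r i - r j) ^+ 3) *: (r i - r j) =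
      \sum_j (m i * m j / enorm (r i - r j) ^+ 3) *: (r i - r j).
    by rewrite [RHS](bigD1 i)//= subrr scaler0 add0r.
  have -> : (omega ^+ 2 * m i) *: r i =
      \sum_j (omega ^+ 2 * m i / total_mass m) *: (m j *: (r i - r j)).
    rewrite -scaler_sumr; under eq_bigr do rewrite scalerBr.
    rewrite sumrB rm subr0 -scaler_suml scalerA -/(total_mass m).
    by rewrite -mulrA mulVf// mulr1.
  rewrite -sumrB; apply: eq_bigr => j _; rewrite scalerA -scalerBl.
  congr (_ *: _).
  (* Abstracting the inverse spares [field] the condition r i != r j. *)
  set e := (enorm _ ^+ 3)^-1; by field.
split=> [cc i|body0 i]; first by rewrite bodyE cc subrr.
by apply/eqP; rewrite -subr_eq0 -bodyE body0.
Qed.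

End CriticalPoints.

Theorem proposition3p2 (R : realType) (n : nat) (m : 'I_n.+1 -> R) (omega : R)
    (q : pair_space R n) (r : 'I_n.+1 -> 'rV[R]_2)
    (m_gt0 : forall i, 0 < m i)
    (omega2_gt0 : 0 < omega ^+ 2)
    (q_neq0 : forall p, q p <> 0)
    (q_triangle : forall p, triangle_defect q p = 0)
    (r_position : underlying_position m q r) :
  (exists phi : multipliers R n,
      critical_point (fun q' => augmented m omega q' phi) q) <->
  central_configuration m omega r.
Proof.
have [rq rm] := r_position.
have q0 p : q p != 0 by apply/eqP.
have M0 : total_mass m != 0.
  rewrite gt_eqF// /total_mass big_ord_recl ltr_pwDl//.
  by apply: sumr_ge0 => i _; exact: ltW.
pose W := body_gradient m omega r.
have gradE p : pair_gradient m omega q p = W (fst_idx p) (snd_idx p).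
  by rewrite /W /body_gradient rq.
pose psi : multipliers R n := fun p =>
  - W (lift ord0 (fst_idx p)) (lift ord0 (snd_idx p)).
(* The multipliers give minus the part of the row sum over bodies 2..N; the gradient of the root
   pair supplies the missing term at body 1, with its sign reversed by antisymmetry. *)
have rootE k : pair_gradient m omega q (root_pair k) +
    \sum_p' triangle_coef R (root_pair k) p' *: psi p' =
    - \sum_j W (lift ord0 k) j.
  under eq_bigr do rewrite triangle_coef_root scalerN.
  rewrite sumrN (sum_incidence (W := fun i j => W (lift ord0 i) (lift ord0 j))).
  - rewrite gradE big_ord_recl opprD; congr (_ + _).
    by rewrite /W -body_gradientC.
  - by move=> i j; exact: body_gradientC.
  - exact: body_gradientii.
rewrite central_configurationP//.
split=> [[phi /(critical_pointP _ _ _ q0) crit]|body0].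
  (* The equation of each tail pair contains a single multiplier, hence determines it. *)
  have phiE : phi = psi.
    apply/funext => p; apply/eqP; rewrite -subr_eq0 /psi opprK addrC.
    by rewrite -(gradE (tail_pair p)) -[phi p]sum_triangle_coef_tail crit.
  have lift0 k : \sum_j W (lift ord0 k) j = 0.
    by apply/eqP; rewrite -oppr_eq0 -rootE -phiE crit.
  (* Exchanging the two summations shows that the double sum equals its own opposite. *)
  have total0 : \sum_i \sum_j W i j = 0.
    have : \sum_i \sum_j W i j = - \sum_i \sum_j W i j.
      rewrite {1}exchange_big -sumrN; apply: eq_bigr => i _.
      by rewrite -sumrN; apply: eq_bigr => j _; exact: body_gradientC.
    move/eqP; rewrite -addr_eq0 -mulr2n -scaler_nat scaler_eq0 pnatr_eq0 /=.
    by move/eqP.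
  move=> i; case: (unliftP ord0 i) => [k ->|->]; first exact: lift0.
  (* All rows but the one at [ord0] vanish, so that row is the whole double sum. *)
  by move: total0; rewrite big_ord_recl [X in _ + X]big1 ?addr0.
exists psi; apply/(critical_pointP _ _ _ q0) => p.
(* Root pairs use the vanishing row sums; for tail pairs [psi] cancels the gradient by its
   choice. *)
have [[k ->]|[p' ->]] := ipair_split p.
  by rewrite rootE body0 oppr0.
by rewrite sum_triangle_coef_tail gradE subrr.
Qed.
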